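(* Let $R$ be a Kähler algebraic curvature operator on a complex Euclidean vector space $(V,g,J)$ of complex dimension $m\geq1$, with scalar curvature $S$, and let $\{e_1,\dots,e_m,Je_1,\dots,Je_m\}$ be an orthonormal basis of $V$. Define $$\varphi^+_{ij}=\tfrac12\left(e_i\odot e_j-Je_i\odot Je_j\right),\qquad \psi^+_{ij}=\tfrac12\left(e_i\odot Je_j+Je_i\odot e_j\right)\qquad(1\leq i<j\leq m),$$ $$\theta_i=\tfrac{1}{2\sqrt2}\left(e_i\odot e_i-Je_i\odot Je_i\right),\qquad \theta_{m+i}=\tfrac{1}{\sqrt2}\,e_i\odot Je_i\qquad(1\leq i\leq m).$$ Then $$\mathring{R}(\varphi^+_{ij},\varphi^+_{ij})=\mathring{R}(\psi^+_{ij},\psi^+_{ij})=2R(e_i,Je_i,e_j,Je_j)$$ for $1\leq i<j\leq m$, and $$\mathring{R}(\theta_i,\theta_i)=\mathring{R}(\theta_{m+i},\theta_{m+i})=R(e_i,Je_i,e_i,Je_i)$$ for $1\leq i\leq m$. Moreover, $$\sum_{1\leq i<j\leq m}\left(\mathring{R}(\varphi^+_{ij},\varphi^+_{ij})+\mathring{R}(\psi^+_{ij},\psi^+_{ij})\right)+\sum_{i=1}^{2m}\mathring{R}(\theta_i,\theta_i)=S.$$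
   Context: A complex Euclidean vector space $(V,g,J)$ of complex dimension $m$ is a real inner product space $(V,g)$ of real dimension $2m$ with an endomorphism $J$ satisfying $J^2=-\operatorname{id}$ and $g(JX,JY)=g(X,Y)$. An algebraic curvature operator on $V$ is a 4-linear form $R$ on $V$ with $R(X,Y,Z,W)=-R(Y,X,Z,W)=-R(X,Y,W,Z)=R(Z,W,X,Y)$ and satisfying the first Bianchi identity $R(X,Y,Z,W)+R(Y,Z,X,W)+R(Z,X,Y,W)=0$. It is called Kähler if moreover $R(X,Y,Z,W)=R(X,Y,JZ,JW)$ for all $X,Y,Z,W\in V$. The sign convention is that $R(X,Y,X,Y)$ is the sectional curvature for orthonormal $X,Y$; the scalar curvature is $S=\sum_{a,b}R(E_a,E_b,E_a,E_b)$ for an orthonormal basis $\{E_a\}$ of $V$. $V$ is identified with $V^*$ via $g$, with $(e_i\otimes e_j)(e_k,e_l)=\delta_{ik}\delta_{jl}$ for an orthonormal basis, and $u\odot v=u\otimes v+v\otimes u$. The curvature operator of the second kind is the symmetric bilinear form on traceless symmetric two-tensors given in an orthonormal basis of $V$ by $\mathring{R}(\varphi,\psi)=\sum_{i,j,k,l}R_{ijkl}\varphi_{il}\psi_{jk}$. *)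

(* Defs.v *)
From HB Require Import structures.
From mathcomp Require Import all_boot all_order all_algebra.
From mathcomp Require Import reals.

Set Implicit Arguments.
Unset Strict Implicit.
Unset Printing Implicit Defensive.

Import Order.TTheory GRing.Theory Num.Theory.
Local Open Scope ring_scope.

Section KahlerCurvature.
Variables (R : realType) (V : vectType R) (g : {dot V for idfun}).

Record complex_structure (J : 'End(V)) : Prop := ComplexStructure {
  cs_sqr : forall x, J (J x) = - x;
  cs_isometry : forall x y, g (J x) (J y) = g x y
}.

(* [scalar f] is the library's linearity of [f : V -> R]. *)
Record curvature_operator (Rm : V -> V -> V -> V -> R) : Prop :=
  CurvatureOperator {
  co_linear1 : forall y z w, scalar (fun x => Rm x y z w);
  co_linear2 : forall x z w, scalar (fun y => Rm x y z w);
  co_linear3 : forall x y w, scalar (fun z => Rm x y z w);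
  co_linear4 : forall x y z, scalar (fun w => Rm x y z w);
  co_skew12 : forall x y z w, Rm x y z w = - Rm y x z w;
  co_skew34 : forall x y z w, Rm x y z w = - Rm x y w z;
  co_pair : forall x y z w, Rm x y z w = Rm z w x y;
  co_bianchi : forall x y z w, Rm x y z w + Rm y z x w + Rm z x y w = 0
}.

Definition kahler (J : 'End(V)) (Rm : V -> V -> V -> V -> R) : Prop :=
  forall x y z w, Rm x y z w = Rm x y (J z) (J w).

Definition orthonormal_basis (E : seq V) : bool :=
  basis_of {:V} E && orthonormal g E.

(* Meaningful for an orthonormal basis E of V; the value does not depend on
   the choice of E. *)
Definition scalar_curvature (Rm : V -> V -> V -> V -> R) (E : seq V) : R :=
  \sum_(a <- E) \sum_(b <- E) Rm a b a b.

(* Two-tensors are represented by their values as bilinear forms, so that the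
   component phi_{ij} in the basis E is [phi E_i E_j].  The sum below is
   sum_{i,j,k,l} R_{ijkl} phi_{il} psi_{jk}, with (a, b, c, d) standing for
   (E_i, E_j, E_k, E_l).  As for the scalar curvature, the value at bilinear
   forms does not depend on the orthonormal basis E. *)
Definition curvature2 (Rm : V -> V -> V -> V -> R) (E : seq V)
    (phi psi : V -> V -> R) : R :=
  \sum_(a <- E) \sum_(b <- E) \sum_(c <- E) \sum_(d <- E)
    Rm a b c d * phi a d * psi b c.

(* u \otimes v under the identification of V with its dual given by g *)
Definition tensor (u v : V) : V -> V -> R := fun x y => g u x * g v y.

Definition symprod (u v : V) : V -> V -> R :=
  fun x y => tensor u v x y + tensor v u x y.

Variables (J : 'End(V)) (m : nat) (e : m.-tuple V).

Definition phi_plus (i j : 'I_m) : V -> V -> R := fun x y =>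
  2^-1 * (symprod (tnth e i) (tnth e j) x y
          - symprod (J (tnth e i)) (J (tnth e j)) x y).

Definition psi_plus (i j : 'I_m) : V -> V -> R := fun x y =>
  2^-1 * (symprod (tnth e i) (J (tnth e j)) x y
          + symprod (J (tnth e i)) (tnth e j) x y).

(* The index set {1, ..., 2m} is 'I_(m + m): theta_i is [theta (lshift m i)]
   and theta_{m+i} is [theta (rshift m i)]. *)
Definition theta (k : 'I_(m + m)) : V -> V -> R := fun x y =>
  match split k with
  | inl i => (2 * Num.sqrt 2)^-1 *
      (symprod (tnth e i) (tnth e i) x y
       - symprod (J (tnth e i)) (J (tnth e i)) x y)
  | inr i => (Num.sqrt 2)^-1 * symprod (tnth e i) (J (tnth e i)) x y
  end.

End KahlerCurvature.

(* Main.v *)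
(** Contraction against an orthonormal basis gives
    R°(u ⊗ v, s ⊗ t) = R(u, s, t, v).  By the Kähler symmetry, R° at
    c (x ⊙ y - Jx ⊙ Jy) and at c (x ⊙ Jy + Jx ⊙ y) reduces to sums of
    R(x, y, x, y) and R(x, Jy, x, Jy), and the Bianchi identity reads
    R(x, Jx, y, Jy) = R(x, y, x, y) + R(x, Jy, x, Jy), so both values are
    8 c^2 R(x, Jx, y, Jy); the thetas are the case x = y.  The same identity
    gives S = 2 sum_{i,j} R(e_i, Je_i, e_j, Je_j), a symmetric double sum. *)
Require Import Defs.
From HB Require Import structures.
From mathcomp Require Import all_boot all_order all_algebra.
From mathcomp Require Import reals.
From mathcomp Require Import ring lra.

Set Implicit Arguments.
Unset Strict Implicit.
Unset Printing Implicit Defensive.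

Import Order.TTheory GRing.Theory Num.Theory.
Local Open Scope ring_scope.

Section OrthonormalBasis.
Variables (R : realType) (V : vectType R) (g : {dot V for idfun}).

Lemma dotC x y : g x y = g y x.
Proof. by rewrite hermC expr0 mul1r. Qed.

Lemma scalar_lincomb (f : V -> R) (I : Type) (r : seq I) (c : I -> R)
    (x : I -> V) :
  scalar f -> f (\sum_(i <- r) c i *: x i) = \sum_(i <- r) c i * f (x i).
Proof.
move=> fL; elim: r => [|i r IH]; last by rewrite !big_cons fL IH.
by rewrite !big_nil; have := fL (-1) 0 0; rewrite scaler0 addr0 mulN1r addNr.
Qed.

Lemma orthonormal_span_expansion (E : seq V) v :
  orthonormal g E -> v \in <<E>>%VS -> v = \sum_(a <- E) g a v *: a.
Proof.
elim: E v => [|x E IH] v.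
  by rewrite span_nil memv0 big_nil => _ /eqP.
rewrite /orthonormal /= => /andP[/andP[/eqP xx EE] /andP[xE oE]].
have IHE w : w \in <<E>>%VS -> w = \sum_(a <- E) g a w *: a.
  by apply: IH; rewrite /orthonormal EE.
have gx0 a : a \in E -> g x a = 0.
  by move: xE; rewrite /= ?andbT => /allP /(_ a) h /h /eqP.
rewrite span_cons => /memv_addP[_ /vlineP[k ->] [w wE ->]].
have gxw : g x w = 0.
  rewrite {1}(IHE w wE) linear_sumr big_seq big1 // => a aE.
  by rewrite linearZr_LR /= gx0 // mulr0.
rewrite big_cons linearDr linearZr_LR /= xx gxw mulr1 addr0; congr (_ + _).
rewrite {1}(IHE w wE) !big_seq; apply: eq_bigr => a aE.
by rewrite linearDr linearZr_LR /= (dotC a x) gx0 // mulr0 add0r.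
Qed.

Lemma orthonormal_expansion (E : seq V) v :
  orthonormal_basis g E -> v = \sum_(a <- E) g a v *: a.
Proof.
move=> /andP[bE oE]; apply: orthonormal_span_expansion => //.
by rewrite (span_basis bE) memvf.
Qed.

Lemma contract_dot (E : seq V) (f : V -> R) v :
  orthonormal_basis g E -> scalar f -> \sum_(a <- E) g v a * f a = f v.
Proof.
move=> bE fL; rewrite [in RHS](orthonormal_expansion v bE) scalar_lincomb //.
by apply: eq_bigr => a _; rewrite dotC.
Qed.

Lemma trace_basis_indep (E F : seq V) (B : V -> V -> R) :
  (forall y, scalar (B^~ y)) -> (forall x, scalar (B x)) ->
  orthonormal_basis g E -> orthonormal_basis g F ->
  \sum_(a <- E) B a a = \sum_(b <- F) B b b.
Proof.
move=> Bl Br bE bF.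
transitivity (\sum_(a <- E) \sum_(b <- F) g a b * B b a).
  by apply: eq_bigr => a _; rewrite (contract_dot _ bF (Bl a)).
rewrite exchange_big /=; apply: eq_bigr => b _.
rewrite -[RHS](contract_dot b bE (Br b)).
by apply: eq_bigr => a _; rewrite dotC.
Qed.

End OrthonormalBasis.

Section Curvature.
Variables (R : realType) (V : vectType R) (g : {dot V for idfun}).
Variables (Rm : V -> V -> V -> V -> R) (hR : curvature_operator Rm).

Lemma scalar_curvature_basis_indep (E F : seq V) :
  orthonormal_basis g E -> orthonormal_basis g F ->
  scalar_curvature Rm E = scalar_curvature Rm F.
Proof.
case: hR => l1 l2 l3 l4 _ _ _ _ bE bF; rewrite /scalar_curvature.
under eq_bigr => a _ do
  rewrite (trace_basis_indep (B := fun x y => Rm a x a y) _ _ bE bF) //.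
rewrite exchange_big [RHS]exchange_big /=; apply: eq_bigr => b _.
by rewrite (trace_basis_indep (B := fun x y => Rm x b y b) _ _ bE bF).
Qed.

Lemma curvature2_tensor (E : seq V) u v s t : orthonormal_basis g E ->
  curvature2 Rm E (tensor g u v) (tensor g s t) = Rm u s t v.
Proof.
case: hR => l1 l2 l3 l4 _ _ _ _ bE; rewrite /curvature2 /tensor.
rewrite -(contract_dot u bE (l1 s t v)); apply: eq_bigr => a _.
rewrite -(contract_dot s bE (l2 a t v)) mulr_sumr; apply: eq_bigr => b _.
rewrite -(contract_dot t bE (l3 a b v)) !mulr_sumr; apply: eq_bigr => c _.
rewrite -(contract_dot v bE (l4 a b c)) !mulr_sumr; apply: eq_bigr => d _.
by ring.
Qed.

Lemma curvature2_lincombl (E : seq V) (I : Type) (r : seq I) (c : I -> R)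
    (f : I -> V -> V -> R) phi psi :
  (forall x y, phi x y = \sum_(i <- r) c i * f i x y) ->
  curvature2 Rm E phi psi = \sum_(i <- r) c i * curvature2 Rm E (f i) psi.
Proof.
move=> phiE; rewrite /curvature2.
under [RHS]eq_bigr => i _ do rewrite mulr_sumr.
rewrite [RHS]exchange_big /=; apply: eq_bigr => a _.
under [RHS]eq_bigr => i _ do rewrite mulr_sumr.
rewrite [RHS]exchange_big /=; apply: eq_bigr => b _.
under [RHS]eq_bigr => i _ do rewrite mulr_sumr.
rewrite [RHS]exchange_big /=; apply: eq_bigr => p _.
under [RHS]eq_bigr => i _ do rewrite mulr_sumr.
rewrite [RHS]exchange_big /=; apply: eq_bigr => d _.
by rewrite phiE mulr_sumr mulr_suml; apply: eq_bigr => i _; ring.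
Qed.

Lemma curvature2C (E : seq V) phi psi :
  curvature2 Rm E phi psi = curvature2 Rm E psi phi.
Proof.
rewrite /curvature2 exchange_big /=; apply: eq_bigr => a _.
apply: eq_bigr => b _; rewrite exchange_big /=; apply: eq_bigr => c _.
apply: eq_bigr => d _.
by rewrite (co_skew12 hR) (co_skew34 hR); ring.
Qed.

Lemma curvature2_lincomb (E : seq V) (I : Type) (r : seq I) (c : I -> R)
    (f : I -> V -> V -> R) phi :
  (forall x y, phi x y = \sum_(i <- r) c i * f i x y) ->
  curvature2 Rm E phi phi
    = \sum_(i <- r) \sum_(j <- r) c i * c j * curvature2 Rm E (f i) (f j).
Proof.
move=> phiE; rewrite (curvature2_lincombl _ _ phiE); apply: eq_bigr => i _.
rewrite curvature2C (curvature2_lincombl _ _ phiE) mulr_sumr.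
by apply: eq_bigr => j _; rewrite curvature2C mulrA.
Qed.

Lemma co_flip x y z w : Rm x y z w = Rm y x w z.
Proof. by rewrite (co_skew12 hR) (co_skew34 hR) opprK. Qed.

Lemma co_rev x y z w : Rm x y z w = Rm w z y x.
Proof. by rewrite (co_pair hR) co_flip. Qed.

Lemma co_diag12 x z w : Rm x x z w = 0.
Proof. by have := co_skew12 hR x x z w; lra. Qed.

Lemma co_oppr3 x y z w : Rm x y (- z) w = - Rm x y z w.
Proof.
have /(_ (-1) z 0) := co_linear3 hR x y w.
have /(_ (-1) z z) := co_linear3 hR x y w.
by rewrite addr0 scaleN1r addNr !mulN1r => ->; lra.
Qed.

Lemma curvature2_symprod (E : seq V) (c p : R) u v s t phi :
  orthonormal_basis g E ->
  (forall x y, phi x y = c * (symprod g u v x y + p * symprod g s t x y)) ->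
  curvature2 Rm E phi phi
  = 2 * c ^+ 2 * (Rm u v u v + 2 * p * (Rm u s t v + Rm u t s v)
                  + p ^+ 2 * Rm s t s t).
Proof.
move=> bE phiE.
pose r := [:: (c, (u, v)); (c, (v, u)); (c * p, (s, t)); (c * p, (t, s))].
rewrite (@curvature2_lincomb E _ r fst
           (fun q => tensor g q.2.1 q.2.2)); last first.
  by move=> x y; rewrite phiE !big_cons big_nil /= /symprod; ring.
rewrite !big_cons !big_nil /= !curvature2_tensor // !co_diag12.
rewrite (co_flip v u v u) (co_flip t s t s) (co_rev v s t u) (co_rev v t s u).
rewrite (co_flip s u v t) (co_flip t u v s) (co_pair hR s v u t).
rewrite (co_pair hR t v u s).
by ring.
Qed.

Section Kahler.
Variables (J : 'End(V)) (hJ : complex_structure g J) (hK : kahler J Rm).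

Lemma kahlerl x y z w : Rm (J x) (J y) z w = Rm x y z w.
Proof. by rewrite (co_pair hR) -hK (co_pair hR). Qed.

Lemma kahler_swap x y z w : Rm x y (J z) w = - Rm x y z (J w).
Proof. by rewrite hK (cs_sqr hJ) co_oppr3. Qed.

Lemma kahler_swap12 x y z w : Rm (J x) y z w = - Rm x (J y) z w.
Proof. by rewrite (co_pair hR) kahler_swap (co_pair hR). Qed.

Lemma holomorphic_bisectional x y :
  Rm x (J x) y (J y) = Rm x y x y + Rm x (J y) x (J y).
Proof.
have := co_bianchi hR x (J x) y (J y).
rewrite kahler_swap12 -(hK y x x y) (co_skew12 hR y x); lra.
Qed.

Lemma curvature2_sym_minus (E : seq V) (c : R) x y phi :
  orthonormal_basis g E ->
  (forall a b, phi a b = c * (symprod g x y a b - symprod g (J x) (J y) a b)) ->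
  curvature2 Rm E phi phi = 8 * c ^+ 2 * Rm x (J x) y (J y).
Proof.
move=> bE phiE.
rewrite (curvature2_symprod (c := c) (p := -1) (u := x) (v := y) (s := J x)
           (t := J y) bE); last by move=> a b; rewrite phiE mulN1r.
rewrite (co_skew34 hR x (J x) (J y)) kahlerl -hK kahler_swap.
rewrite holomorphic_bisectional; ring.
Qed.

Lemma curvature2_sym_plus (E : seq V) (c : R) x y phi :
  orthonormal_basis g E ->
  (forall a b, phi a b = c * (symprod g x (J y) a b + symprod g (J x) y a b)) ->
  curvature2 Rm E phi phi = 8 * c ^+ 2 * Rm x (J x) y (J y).
Proof.
move=> bE phiE.
rewrite (curvature2_symprod (c := c) (p := 1) (u := x) (v := J y) (s := J x)
           (t := y) bE); last by move=> a b; rewrite phiE mul1r.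
rewrite -hK kahler_swap12 kahler_swap opprK holomorphic_bisectional; ring.
Qed.

Lemma scalar_curvature_unitary (m : nat) (e : m.-tuple V) :
  scalar_curvature Rm (e ++ [seq J x | x <- e])
  = 2 * \sum_(i < m) \sum_(j < m)
          Rm (tnth e i) (J (tnth e i)) (tnth e j) (J (tnth e j)).
Proof.
rewrite /scalar_curvature big_cat big_map /= -big_split /= big_tuple mulr_sumr.
apply: eq_bigr => i _.
rewrite !big_cat !big_map /= !big_tuple -!big_split /= mulr_sumr.
apply: eq_bigr => j _; rewrite holomorphic_bisectional.
rewrite kahlerl -hK kahler_swap12 kahler_swap; ring.
Qed.

End Kahler.

End Curvature.

Lemma sum_sym_offdiag (R : pzRingType) (m : nat) (H : 'I_m -> 'I_m -> R) :
  (forall i j, H i j = H j i) ->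
  \sum_(i < m) \sum_(j < m) H i j
    = 2 * \sum_(i < m) \sum_(j < m | (i < j)%N) H i j + \sum_(i < m) H i i.
Proof.
move=> Hs.
have Hlow : \sum_(i < m) \sum_(j < m | (j < i)%N) H i j
          = \sum_(i < m) \sum_(j < m | (i < j)%N) H i j.
  rewrite (exchange_big_dep xpredT) //=; apply: eq_bigr => i _.
  by apply: eq_bigr => j _.
rewrite mulr_natl mulr2n -{1}Hlow -!big_split /=; apply: eq_bigr => i _.
rewrite (bigID (fun j : 'I_m => (i < j)%N)) /= addrC (bigD1 i) ?ltnn //=.
rewrite [RHS]addrC addrA; congr (_ + _ + _); apply: eq_bigl => j.
by rewrite -leqNgt ltn_neqAle andbC.
Qed.

Theorem lemma4p3 (R : realType) (V : vectType R) (g : {dot V for idfun})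
    (J : 'End(V)) (m : nat) (hm : (1 <= m)%N)
    (hdim : \dim {:V} = (2 * m)%N) (hJ : complex_structure g J)
    (Rm : V -> V -> V -> V -> R) (hR : curvature_operator Rm)
    (hK : kahler J Rm)
    (E : seq V) (hE : orthonormal_basis g E)
    (F : seq V) (hF : orthonormal_basis g F)
    (S : R) (hS : S = scalar_curvature Rm F)
    (e : m.-tuple V) (he : orthonormal_basis g (e ++ [seq J x | x <- e])) :
  [/\ forall i j : 'I_m, (i < j)%N ->
        curvature2 Rm E (phi_plus g J e i j) (phi_plus g J e i j)
          = 2 * Rm (tnth e i) (J (tnth e i)) (tnth e j) (J (tnth e j))
        /\ curvature2 Rm E (psi_plus g J e i j) (psi_plus g J e i j)
          = 2 * Rm (tnth e i) (J (tnth e i)) (tnth e j) (J (tnth e j)),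
      forall i : 'I_m,
        curvature2 Rm E (theta g J e (lshift m i)) (theta g J e (lshift m i))
          = Rm (tnth e i) (J (tnth e i)) (tnth e i) (J (tnth e i))
        /\ curvature2 Rm E (theta g J e (rshift m i)) (theta g J e (rshift m i))
          = Rm (tnth e i) (J (tnth e i)) (tnth e i) (J (tnth e i))
    & \sum_(i < m) \sum_(j < m | (i < j)%N)
        (curvature2 Rm E (phi_plus g J e i j) (phi_plus g J e i j)
         + curvature2 Rm E (psi_plus g J e i j) (psi_plus g J e i j))
      + \sum_(k < m + m) curvature2 Rm E (theta g J e k) (theta g J e k)
      = S].
Proof.
have hphi (i j : 'I_m) :
  curvature2 Rm E (phi_plus g J e i j) (phi_plus g J e i j)
  = 2 * Rm (tnth e i) (J (tnth e i)) (tnth e j) (J (tnth e j)).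
  rewrite (curvature2_sym_minus hR hJ hK hE (c := 2^-1)
             (x := tnth e i) (y := tnth e j)) //.
  by move: (Rm _ _ _ _) => H; field.
have hpsi (i j : 'I_m) :
  curvature2 Rm E (psi_plus g J e i j) (psi_plus g J e i j)
  = 2 * Rm (tnth e i) (J (tnth e i)) (tnth e j) (J (tnth e j)).
  rewrite (curvature2_sym_plus hR hJ hK hE (c := 2^-1)
             (x := tnth e i) (y := tnth e j)) //.
  by move: (Rm _ _ _ _) => H; field.
have sq2 : Num.sqrt 2 ^+ 2 = 2 :> R by rewrite sqr_sqrtr.
have cE : 8 * (2 * Num.sqrt 2)^-1 ^+ 2 = 1 :> R.
  by rewrite exprVn exprMn sq2; field.
have htheta1 (i : 'I_m) :
  curvature2 Rm E (theta g J e (lshift m i)) (theta g J e (lshift m i))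
  = Rm (tnth e i) (J (tnth e i)) (tnth e i) (J (tnth e i)).
  rewrite (curvature2_sym_minus hR hJ hK hE (c := (2 * Num.sqrt 2)^-1)
             (x := tnth e i) (y := tnth e i)) ?cE ?mul1r // => a b.
  by rewrite /theta (unsplitK (inl i)).
have htheta2 (i : 'I_m) :
  curvature2 Rm E (theta g J e (rshift m i)) (theta g J e (rshift m i))
  = Rm (tnth e i) (J (tnth e i)) (tnth e i) (J (tnth e i)).
  rewrite (curvature2_sym_plus hR hJ hK hE (c := (2 * Num.sqrt 2)^-1)
             (x := tnth e i) (y := tnth e i)) ?cE ?mul1r // => a b.
  rewrite /theta (unsplitK (inr i)) /symprod invfM.
  by move: (Num.sqrt 2)^-1 => k; field.
split=> [i j _|i|]; [by split | by split |].
rewrite hS (scalar_curvature_basis_indep hR hF he).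
rewrite (scalar_curvature_unitary hR hJ hK) sum_sym_offdiag; last first.
  by move=> i j; apply: (co_pair hR).
rewrite big_split_ord /=.
under [X in _ + (X + _)]eq_bigr => i _ do rewrite htheta1.
under [X in _ + (_ + X)]eq_bigr => i _ do rewrite htheta2.
rewrite mulrDr mulrA; congr (_ + _); last by ring.
rewrite mulr_sumr; apply: eq_bigr => i _.
rewrite mulr_sumr; apply: eq_bigr => j _.
by rewrite hphi hpsi; ring.
Qed.
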